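(* Let $X_{N,k}^{\mathrm{loc}},Y_{N,k}^{\mathrm{cl}},Z_{\Lambda,k}^{\mathrm{loc}},Z_{\Lambda,k}^{\mathrm{PFE}}$ be finite-dimensional normed spaces with maps $\Theta_{\Lambda,k}^N:X_{N,k}^{\mathrm{loc}}\to Y_{N,k}^{\mathrm{cl}}$, $T_{\Lambda,k}^{\mathrm{loc}}:X_{N,k}^{\mathrm{loc}}\to Z_{\Lambda,k}^{\mathrm{loc}}$, $T_{\Lambda,k}^{\mathrm{PFE}}:Y_{N,k}^{\mathrm{cl}}\to Z_{\Lambda,k}^{\mathrm{PFE}}$, $J_{\Lambda,k}:Z_{\Lambda,k}^{\mathrm{loc}}\to Z_{\Lambda,k}^{\mathrm{PFE}}$. Let $\mathrm{Err}_{\mathrm{red},k}$ be a residual functional on $X_{N,k}^{\mathrm{loc}}$ and $C_{\mathrm{res},k},\Delta_{\mathrm{det},k}\ge0$ constants such that for all $D\in X_{N,k}^{\mathrm{loc}}$ $$\bigl\|T_{\Lambda,k}^{\mathrm{PFE}}\Theta_{\Lambda,k}^N(D)-J_{\Lambda,k}T_{\Lambda,k}^{\mathrm{loc}}(D)\bigr\|_{Z_{\Lambda,k}^{\mathrm{PFE}}}\le C_{\mathrm{res},k}\,\mathrm{Err}_{\mathrm{red},k}(D)+\Delta_{\mathrm{det},k}.$$ Assume there are constants $c_{J,k}>0$ and $\Delta_{J,k}\ge0$ such that for all $D\in X_{N,k}^{\mathrm{loc}}$ $$\|T_{\Lambda,k}^{\mathrm{loc}}D\|_{Z_{\Lambda,k}^{\mathrm{loc}}}\ge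 c_{J,k}\|J_{\Lambda,k}T_{\Lambda,k}^{\mathrm{loc}}D\|_{Z_{\Lambda,k}^{\mathrm{PFE}}}-\Delta_{J,k}.$$ Then for every $D\in X_{N,k}^{\mathrm{loc}}$, $$M_{\Lambda,k}^{\mathrm{loc}}(D)\ge c_{J,k}M_{\Lambda,k}^{\mathrm{PFE}}\bigl(\Theta_{\Lambda,k}^ND\bigr)-c_{J,k}C_{\mathrm{res},k}\,\mathrm{Err}_{\mathrm{red},k}(D)-c_{J,k}\Delta_{\mathrm{det},k}-\Delta_{J,k}.$$
   Context: $M_{\Lambda,k}^{\mathrm{loc}}(D):=\|T_{\Lambda,k}^{\mathrm{loc}}D\|_{Z_{\Lambda,k}^{\mathrm{loc}}}$ for $D\in X_{N,k}^{\mathrm{loc}}$ and $M_{\Lambda,k}^{\mathrm{PFE}}(d):=\|T_{\Lambda,k}^{\mathrm{PFE}}d\|_{Z_{\Lambda,k}^{\mathrm{PFE}}}$ for $d\in Y_{N,k}^{\mathrm{cl}}$. (Interpretation: $\Theta$ is the reduced clean chart, $T^{\mathrm{loc}}$ and $T^{\mathrm{PFE}}$ are the reduced local and clean pressure--flux--energy detector/tax maps, $J$ is the observation transport map.) $\mathrm{Err}_{\mathrm{red},k}$ is real-valued. *)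

(* Defs.v *)
From HB Require Import structures.
From mathcomp Require Import all_boot all_order all_algebra.
From mathcomp Require Import all_classical reals topology normedtype.

Set Implicit Arguments.
Unset Strict Implicit.
Unset Printing Implicit Defensive.

Import Order.TTheory GRing.Theory Num.Theory.
Import numFieldNormedType.Exports.

Local Open Scope ring_scope.

(* Finite-dimensional normed spaces: the [Vector] structure provides a linear
   isomorphism with some 'rV[K]_n, and the norm is arbitrary (it need not be
   the one transported from 'rV[K]_n). *)
#[short(type="finNormedModType")]
HB.structure Definition FinNormedModule (K : numFieldType) :=
  {V of NormedModule K V & Vector K V}.

(* The detectors are arbitrary maps; linearity and continuity are not assumed. *)
Definition M_loc (R : realType) (X Zloc : finNormedModType R)
    (Tloc : X -> Zloc) (D : X) : R := `|Tloc D|.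

Definition M_PFE (R : realType) (Y ZPFE : finNormedModType R)
    (TPFE : Y -> ZPFE) (d : Y) : R := `|TPFE d|.

(* Main.v *)
Require Import Defs.
From HB Require Import structures.
From mathcomp Require Import all_boot all_order all_algebra.
From mathcomp Require Import all_classical reals topology normedtype.

Import Order.TTheory GRing.Theory Num.Theory.
Import numFieldNormedType.Exports.

Local Open Scope ring_scope.

(** The reverse triangle inequality turns the [intertwining] bound on a difference in [ZPFE] into a
    bound on a difference of norms, so [J (Tloc D)] is at least as large as [TPFE (Theta D)] up to
    the residual and the defect. Scaling by [c_J] and inserting this into [transport] gives the
    claim. *)

Theorem theorem6p15 (R : realType)
    (X Y Zloc ZPFE : finNormedModType R)
    (Theta : X -> Y) (Tloc : X -> Zloc) (TPFE : Y -> ZPFE) (J : Zloc -> ZPFE)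
    (Err_red : X -> R) (C_res Delta_det : R)
    (C_res_ge0 : 0 <= C_res) (Delta_det_ge0 : 0 <= Delta_det)
    (intertwining : forall D : X,
      `|TPFE (Theta D) - J (Tloc D)| <= C_res * Err_red D + Delta_det)
    (c_J Delta_J : R) (c_J_gt0 : 0 < c_J) (Delta_J_ge0 : 0 <= Delta_J)
    (transport : forall D : X,
      `|Tloc D| >= c_J * `|J (Tloc D)| - Delta_J) :
  forall D : X,
    M_loc Tloc D >= c_J * M_PFE TPFE (Theta D)
      - c_J * C_res * Err_red D - c_J * Delta_det - Delta_J.
Proof.
move=> D; rewrite /M_loc /M_PFE.
apply: le_trans (transport D).
(* [Delta_J] cancels, and positivity of [c_J] lets it be divided out; regrouping leaves the
   difference of the two [ZPFE] norms bounded by [C_res * Err_red D + Delta_det]. *)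
rewrite lerD2r -mulrA -!mulrBr ler_pM2l // -addrA -opprD lerBlDr -lerBlDl.
exact: le_trans (lerB_dist _ _) (intertwining D).
Qed.
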